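(* There are universal constants $c,C>0$ such that the following holds. Let $T$ be a finite nonempty set with two semi-metrics $d_1,d_2$, let $\mathcal{X}$ be a normed linear space, and let $(X_t)_{t\in T}$ be an $\mathcal{X}$-valued process which has a mixed tail with respect to the pair $(d_1,d_2)$. Then for any $t_0\in T$ and any $1\leq p<\infty$, $$\Big(\mathbb{E}\sup_{t\in T}\|X_t-X_{t_0}\|^p\Big)^{1/p}\leq C\big(\gamma_2(T,d_2)+\gamma_1(T,d_1)\big)+2\sup_{t\in T}\big(\mathbb{E}\|X_t-X_{t_0}\|^p\big)^{1/p}.$$ As a consequence, for any $t_0\in T$ and any $u\geq 1$, $$\mathbb{P}\Big(\sup_{t\in T}\|X_t-X_{t_0}\|> C\big(\gamma_2(T,d_2)+\gamma_1(T,d_1)\big)+c\big(\sqrt{u}\,\Delta_{d_2}(T)+u\,\Delta_{d_1}(T)\big)\Big)\leq e^{-u}.$$ (The constant $C$ in the second bound need not be the same as in the first.)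
   Context: A semi-metric $d$ on $T$ is a function $d:T\times T\to[0,\infty)$ with $d(x,x)=0$, $d(x,y)=d(y,x)$ and $d(x,z)\leq d(x,y)+d(y,z)$ (distinct points may have distance $0$). The diameter is $\Delta_d(T)=\sup_{s,t\in T}d(s,t)$. The process $(X_t)_{t\in T}$ (with all norms $\|X_t-X_s\|$ measurable) has a mixed tail with respect to $(d_1,d_2)$ if for all $s,t\in T$ and all $u\geq 0$, $$\mathbb{P}\big(\|X_t-X_s\|>\sqrt{u}\,d_2(t,s)+u\,d_1(t,s)\big)\leq 2e^{-u}.$$ A sequence $\mathcal{T}=(T_n)_{n\geq 0}$ of nonempty subsets of $T$ is admissible if $|T_0|=1$ and $|T_n|\leq 2^{2^n}$ for all $n\geq 1$. For $0<\alpha<\infty$, $\gamma_\alpha(T,d)=\inf_{\mathcal{T}}\sup_{t\in T}\sum_{n=0}^\infty 2^{n/\alpha}d(t,T_n)$, where $d(t,T_n)=\inf_{s\in T_n}d(t,s)$ and the infimum is over all admissible sequences. *)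

(* Defs.v *)
From HB Require Import structures.
From mathcomp Require Import all_boot all_order all_algebra.
From mathcomp Require Import all_classical all_reals all_analysis.
Set Implicit Arguments.
Unset Strict Implicit.
Unset Printing Implicit Defensive.
Import Order.TTheory GRing.Theory Num.Theory.
Import numFieldNormedType.Exports.
Local Open Scope classical_set_scope.
Local Open Scope ring_scope.

(* Distinct points may be at distance 0. *)
Definition semimetric (R : realType) (T : Type) (d : T -> T -> R) : Prop :=
  [/\ forall x y, 0 <= d x y,
      forall x, d x x = 0,
      forall x y, d x y = d y x &
      forall x y z, d x z <= d x y + d y z].

(* The suprema and infima in R below are junk (0) when the set is empty or
   unbounded; neither happens for T finite and inhabited, A nonempty. *)
Definition diameter (R : realType) (T : finType) (d : T -> T -> R) : R :=
  sup [set d s t | s in [set: T] & t in [set: T]].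

Definition dist_set (R : realType) (T : finType) (d : T -> T -> R)
    (t : T) (A : {set T}) : R :=
  inf [set d t s | s in [set` A]].

Definition admissible (T : finType) (A : nat -> {set T}) : Prop :=
  [/\ forall n, A n != finset.set0,
      #|A 0%N| = 1%N &
      forall n, (1 <= n)%N -> (#|A n| <= 2 ^ (2 ^ n))%N].

Definition gamma_functional (R : realType) (T : finType) (alpha : R)
    (d : T -> T -> R) : \bar R :=
  ereal_inf [set ereal_sup (range (fun t : T =>
      (\sum_(0 <= n <oo) (2 `^ (n%:R / alpha) * dist_set d t (A n))%:E)%E))
    | A in [set A : nat -> {set T} | admissible A]].

Definition mixed_tail (R : realType) (disp : measure_display)
    (Omega : measurableType disp) (P : probability Omega R)
    (T : finType) (V : normedModType R) (X : T -> Omega -> V)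
    (d1 d2 : T -> T -> R) : Prop :=
  forall (s t : T) (u : R), 0 <= u ->
    (P [set w | (Num.sqrt u * d2 t s + u * d1 t s < `|X t w - X s w|)%R]
      <= (2 * expR (- u))%:E)%E.

(* Main.v *)
(* For p >= 1 let m be the level with 2^(m+2) <= p <= 2^(m+3) (m = 0 if p < 4). At
   level m the chain visits at most 2^p points, so the L^p norm of the maximum
   over them is at most twice the largest single L^p norm. Above level m, a union
   bound over all links at levels n >= m shows that, off an event of probability
   at most exp(-2pv), every link x -> y at level n satisfies
   |X_x - X_y| <= 30 v (2^(n/2) d2(x,y) + 2^n d1(x,y)); summing along the chain
   gives |X_t - X_(r t)| <= 300 v (gamma_2 + gamma_1) for all t. Integrating this
   tail gives the moment bound by Minkowski's inequality, and v = 1, p = u with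
   a union bound over the at most 2^u starting points gives the tail bound.

   Controlling both semi-metrics with a single chain requires cells, not nets:
   [rho n] picks a representative of the cell of points sharing their nearest
   points in A_n (for d2) and B_n (for d1) and the dyadic scales of their
   distances to these. *)
Require Import Defs.
From HB Require Import structures.
From mathcomp Require Import all_boot all_order all_algebra.
From mathcomp Require Import all_classical all_reals all_analysis.
From mathcomp Require Import measurable_realfun ring lra zify.
Set Implicit Arguments.
Unset Strict Implicit.
Unset Printing Implicit Defensive.
Import Order.TTheory GRing.Theory Num.Theory.
Import numFieldNormedType.Exports.
Local Open Scope classical_set_scope.
Local Open Scope ring_scope.

(** * Nearest points, cells and the common chain *)

Lemma dist_set_attained (R : realType) (T : finType) (d : T -> T -> R) (t : T)
    (A : {set T}) :
  A != finset.set0 -> exists2 s, s \in A & d t s = dist_set d t A.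
Proof.
move=> /set0Pn[s0 As0].
case: (arg_minP (d t) As0) => s As smin; exists s => //.
have lbs : lbound [set d t x | x in [set` A]] (d t s).
  by move=> _ [x Ax <-]; exact: smin.
apply/eqP; rewrite eq_le; apply/andP; split.
- by apply: lb_le_inf => //; exists (d t s), s.
- by apply: ge_inf; [exists (d t s) | exists s].
Qed.

Lemma dist_set_ge0 (R : realType) (T : finType) (d : T -> T -> R) (t : T)
    (A : {set T}) : (forall x y, 0 <= d x y) -> 0 <= dist_set d t A.
Proof.
move=> d0; have [->|A0] := eqVneq A finset.set0.
  rewrite /dist_set (_ : [set` finset.set0] = set0) ?image_set0 ?inf0//.
  by apply/seteqP; split=> x //=; rewrite finset.in_set0.
by have [s _ <-] := dist_set_attained d t A0.
Qed.

(** Picks a representative of each cell: [g (f t)] depends only on the label of [t] and carries that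
    same label. *)
Lemma finite_section (T : finType) (U : eqType) (f : T -> U) (t0 : T) :
  exists g : U -> T, forall t, f (g (f t)) = f t.
Proof.
exists (fun u => odflt t0 [pick t | f t == u]) => t.
by case: pickP => [s /eqP//|/(_ t)]; rewrite eqxx.
Qed.

(* Nearest-point cells alone do not suffice: two points of the same cell may be
   at very different distances from its centre. The label also records the
   dyadic scale of that distance, down to [g / 4 ^ n]. *)
Lemma net_labels (R : realType) (T : finType) (d : T -> T -> R) (n : nat)
    (A : {set T}) (g : R) :
  semimetric d -> A != finset.set0 -> (forall t, dist_set d t A <= g) ->
  exists lab : T -> T * 'I_(n.*2.+1),
    (#|[set lab t | t : T]%SET| <= #|A| * n.*2.+1)%N /\
    forall s t, lab s = lab t -> d t s <= 3 * dist_set d t A + g / 4 ^+ n.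
Proof.
move=> [d0 dxx dC dT] A0 Dg.
have /choice[a /all_and2[aA ad]] : forall t, exists s,
    s \in A /\ d t s = dist_set d t A.
  by move=> t; have [s] := dist_set_attained d t A0; exists s.
(* [k t] is the first [j < 2n] at which the distance of [t] to [A] exceeds [g / 2^(j+1)], and [2n]
   if there is none. *)
pose far t j := g / 2 ^+ j.+1 < dist_set d t A.
pose k t := find (far t) (iota 0 n.*2).
have kn t : (k t < n.*2.+1)%N.
  by rewrite ltnS -[leqRHS](size_iota 0) find_size.
exists (fun t => (a t, Ordinal (kn t))); split.
  rewrite -[n.*2.+1 in leqRHS]card_ord -cardsT -finset.cardsX.
  apply/subset_leq_card/fintype.subsetP => _ /imsetP[t _ ->].
  by rewrite finset.in_setX aA finset.in_setT.
move=> s t [ast kst].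
have g0 : 0 <= g by rewrite (le_trans _ (Dg t))// dist_set_ge0.
have ds : d t s <= dist_set d t A + dist_set d s A.
  by rewrite -!ad ast (dC s) dT.
(* The scale just before [k s] fails the test [far]; for [k s = 0] the global bound [g] serves. *)
have ks : dist_set d s A <= g / 2 ^+ k s.
  case Ek : (k s) => [|j]; first by rewrite expr0 divr1.
  have jk : (j < k s)%N by rewrite Ek.
  have := before_find 0%N jk; rewrite nth_iota /far ?add0n.
    by move/negbT; rewrite -leNgt.
  by have := kn s; rewrite Ek ltnS.
have Dt0 : 0 <= dist_set d t A by exact: dist_set_ge0.
have gn0 : 0 <= g / 4 ^+ n by rewrite divr_ge0// exprn_ge0.
suff : dist_set d s A <= 2 * dist_set d t A + g / 4 ^+ n by lra.
(* If the common scale is below [2n], the lower bound it gives for [t] is half the upper bound for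
   [s]. At scale [2n] the upper bound is [g / 4^n], the additive error. *)
have [ltk|] := ltnP (k t) n.*2.
  have : far t (k t).
    have := @nth_find _ 0%N (far t) (iota 0 n.*2).
    by rewrite has_find size_iota -/(k t) nth_iota// add0n; apply.
  rewrite /far exprS invfM -kst; move: ks; lra.
rewrite leq_eqVlt ltnNge -ltnS kn orbF => /eqP nk.
by move: ks; rewrite kst -nk -mul2n exprM -natrX; lra.
Qed.

(** Pairing the labels for [d2] and [d1] makes one representative good for both semi-metrics. The
    pairing and the [(2n+1)^2] scales only raise the exponent from [2^n] to [2^(n+2)]. Taking the
    identity at high levels makes every chain end at its own point. *)
Lemma joint_chain (R : realType) (T : finType) (d1 d2 : T -> T -> R)
    (A B : nat -> {set T}) (g1 g2 : R) (t0 : T) :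
  semimetric d1 -> semimetric d2 -> admissible A -> admissible B ->
  (forall n t, dist_set d2 t (A n) <= g2) ->
  (forall n t, dist_set d1 t (B n) <= g1) ->
  exists rho : nat -> T -> T,
    [/\ #|[set rho 0%N t | t : T]%SET| = 1%N,
        forall n, (#|[set rho n t | t : T]%SET| <= 2 ^ 2 ^ n.+2)%N,
        forall n t, (#|T| < n)%N -> rho n t = t,
        forall n t, d2 t (rho n t) <= 3 * dist_set d2 t (A n) + g2 / 4 ^+ n &
        forall n t, d1 t (rho n t) <= 3 * dist_set d1 t (B n) + g1 / 4 ^+ n].
Proof.
move=> sd1 sd2 [A0 A1 AS] [B0 B1 BS] Ag Bg.
have /choice[r /all_and3[rc r2 r1]] : forall n, exists r : T -> T, [/\
    (#|[set r t | t : T]%SET| <= #|A n| * n.*2.+1 * (#|B n| * n.*2.+1))%N,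
    forall t, d2 t (r t) <= 3 * dist_set d2 t (A n) + g2 / 4 ^+ n &
    forall t, d1 t (r t) <= 3 * dist_set d1 t (B n) + g1 / 4 ^+ n].
  move=> n.
  have [a [ac a2]] := net_labels n sd2 (A0 n) (Ag n).
  have [b [bc b1]] := net_labels n sd1 (B0 n) (Bg n).
  have [g gP] := finite_section (fun t => (a t, b t)) t0.
  exists (fun t => g (a t, b t)); split=> [|t|t].
  - apply: leq_trans (leq_mul ac bc); rewrite -finset.cardsX.
    apply: leq_trans (leq_imset_card g _); apply/subset_leq_card.
    apply/fintype.subsetP => _ /imsetP[t _ ->]; apply: imset_f.
    by rewrite finset.in_setX !imset_f.
  - by apply: a2; case: (gP t).
  - by apply: b1; case: (gP t).
exists (fun n t => if (#|T| < n)%N then t else r n t).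
have [d20 d2xx _ _] := sd2; have [d10 d1xx _ _] := sd1.
have gg2 : 0 <= g2 by rewrite (le_trans _ (Ag 0%N t0))// dist_set_ge0.
have gg1 : 0 <= g1 by rewrite (le_trans _ (Bg 0%N t0))// dist_set_ge0.
have grow n : (n < 2 ^ n)%N by rewrite ltn_expl.
split=> //=.
- apply/eqP; rewrite eqn_leq; apply/andP; split.
    by have := rc 0%N; rewrite A1 B1.
  by apply/card_gt0P; exists (r 0%N t0); apply: imset_f.
- move=> n; case: ltnP => [Tn|Tn].
    apply: leq_trans (max_card _) _; apply: leq_trans (ltnW Tn) _.
    apply: leq_trans (ltnW (grow n)) _; rewrite leq_exp2l//.
    by apply: leq_trans (ltnW (grow n)) _; rewrite leq_exp2l//; lia.
  apply: leq_trans (rc n) _; case: n {Tn} => [|n]; first by rewrite A1 B1.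
  (* Each of the four factors is at most [2 ^ 2 ^ n.+1], so the product is at most
     [2 ^ 2 ^ n.+3]. *)
  have scales : (n.+1.*2.+1 <= 2 ^ 2 ^ n.+1)%N.
    rewrite (@leq_trans (2 ^ n.+2))// ?leq_exp2l//.
    by have := grow n.+1; rewrite (expnS _ n.+1); lia.
  have -> : (2 ^ 2 ^ n.+3 = 2 ^ 2 ^ n.+1 * 2 ^ 2 ^ n.+1
                           * (2 ^ 2 ^ n.+1 * 2 ^ 2 ^ n.+1))%N.
    by rewrite -!expnD; congr expn; rewrite !expnS; lia.
  by rewrite !leq_mul ?AS ?BS.
- by move=> n t ->.
- move=> n t; case: ifP => // _.
  by rewrite d2xx addr_ge0 ?mulr_ge0 ?dist_set_ge0// divr_ge0// exprn_ge0.
- move=> n t; case: ifP => // _.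
  by rewrite d1xx addr_ge0 ?mulr_ge0 ?dist_set_ge0// divr_ge0// exprn_ge0.
Qed.

Lemma sum_geometric_half_le (R : realType) (n : nat) :
  \sum_(0 <= k < n) (2^-1 : R) ^+ k <= 2.
Proof.
suff -> : \sum_(0 <= k < n) (2^-1 : R) ^+ k = 2 - 2 / 2 ^+ n.
  by rewrite gerBl divr_ge0// exprn_ge0.
elim: n => [|n IH]; first by rewrite big_nil expr0; lra.
by rewrite big_nat_recr//= IH exprS invfM exprVn; lra.
Qed.

(** The triangle inequality through [t] bounds link [n] by [e n + e n.+1], where monotone weights
    allow the far end to be charged at level [n.+1]. Since [w n <= 2^n], the errors [g / 4^n]
    contribute at most [2 * g], so the [e n] sum to at most [3 * g + 2 * g]; each is used at most
    twice, whence 10. *)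
Lemma chain_sum_le (R : realType) (T : finType) (d : T -> T -> R)
    (w D : nat -> R) (rho : nat -> T -> T) (t : T) (g : R) (m M : nat) :
  semimetric d ->
  (forall n, 0 <= w n <= 2 ^+ n) -> {homo w : i j / (i <= j)%N >-> i <= j} ->
  0 <= g -> (forall n, 0 <= D n) ->
  (forall n, \sum_(0 <= k < n) w k * D k <= g) ->
  (forall n, d t (rho n t) <= 3 * D n + g / 4 ^+ n) ->
  \sum_(m <= n < M) w n * d (rho n.+1 t) (rho n t) <= 10 * g.
Proof.
move=> [d0 _ dC dT] w2 wi g0 D0 Dg dD.
have w0 n : 0 <= w n by case/andP: (w2 n).
pose e n := w n * (3 * D n + g / 4 ^+ n).
have e0 n : 0 <= e n.
  by rewrite mulr_ge0// addr_ge0 ?divr_ge0 ?exprn_ge0// mulr_ge0.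
have e_le N : \sum_(0 <= n < N) e n <= 5 * g.
  have -> : 5 * g = 3 * g + g * 2 by lra.
  apply: (@le_trans _ _ (\sum_(0 <= n < N) (3 * (w n * D n) + g * 2^-1 ^+ n))).
    apply: ler_sum => n _; rewrite /e mulrDr mulrCA lerD2l mulrCA ler_wpM2l//.
    have /andP[_ /ler_wpM2r] := w2 n => /(_ ((4 : R) ^- n)).
    rewrite invr_ge0 exprn_ge0// => /(_ isT) /le_trans; apply.
    by rewrite -exprVn -exprMn (_ : 2 * 4^-1 = 2^-1)//; lra.
  by rewrite big_split/= -!mulr_sumr lerD// ler_wpM2l// sum_geometric_half_le.
have link n : w n * d (rho n.+1 t) (rho n t) <= e n + e n.+1.
  apply: (@le_trans _ _ (w n * (d t (rho n t) + d t (rho n.+1 t)))).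
    by rewrite ler_wpM2l// addrC (dC t (rho n.+1 t)) dT.
  rewrite mulrDr lerD ?ler_wpM2l//.
  apply: (@le_trans _ _ (w n.+1 * d t (rho n.+1 t))).
    by rewrite ler_wpM2r// wi.
  by rewrite ler_wpM2l.
have -> : 10 * g = 5 * g + 5 * g by lra.
apply: (@le_trans _ _ (\sum_(0 <= n < M) (e n + e n.+1))).
  have [mM|Mm] := leqP m M; last first.
    by rewrite big_geq ?(ltnW Mm)// sumr_ge0// => i _; rewrite addr_ge0.
  rewrite [leRHS](big_cat_nat (leq0n m) mM)/= -[leLHS]add0r lerD//.
    by rewrite sumr_ge0// => i _; rewrite addr_ge0.
  by apply: ler_sum.
rewrite big_split/= lerD//.
have := e_le M.+1; rewrite big_nat_recl//=.
by apply: le_trans; rewrite lerDr.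
Qed.

(** * Union bound over the links *)

Lemma measurable_gt (R : realType) (disp : measure_display)
    (Omega : measurableType disp) (f : Omega -> R) (a : R) :
  measurable_fun [set: Omega] f -> measurable [set w | a < f w].
Proof.
move=> mf; rewrite (_ : [set w | _] = [set: Omega] `&` f @^-1` `]a, +oo[).
  exact: mf.
by rewrite setTI; apply/seteqP; split=> w /=; rewrite in_itv/= andbT.
Qed.

Lemma union_bound (R : realType) (disp : measure_display)
    (Omega : measurableType disp) (P : probability Omega R) (I : choiceType)
    (s : seq I) (F : I -> set Omega) (e : I -> R) :
  {in s, forall i, measurable (F i)} -> {in s, forall i, (P (F i) <= (e i)%:E)%E} ->
  measurable (\bigcup_(i in [set` s]) F i) /\
  (P (\bigcup_(i in [set` s]) F i) <= (\sum_(i <- s) e i)%:E)%E.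
Proof.
elim: s => [|x s IH] mF eF.
  rewrite big_nil (_ : \bigcup_(i in _) _ = set0) ?measure0//.
  by apply/seteqP; split=> // w [].
have [||ms es] := IH; [by move=> i si; apply: mF; rewrite inE si orbT..|
  by move=> i si; apply: eF; rewrite inE si orbT|].
have mx : measurable (F x) by apply: mF; rewrite inE eqxx.
rewrite (_ : \bigcup_(i in [set` x :: s]) _ = F x `|` \bigcup_(i in [set` s]) F i).
  split; first exact: measurableU.
  rewrite big_cons EFinD; apply: le_trans (measureU2 _ mx ms) _.
  by rewrite leeD// eF// inE eqxx.
apply/seteqP; split=> [w [i /=]|w].
  by rewrite inE => /orP[/eqP->|si] Fw; [left|right; exists i].
case=> [Fw|[i /= si Fw]]; first by exists x => //=; rewrite inE eqxx.
by exists i => //=; rewrite inE si orbT.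
Qed.

Lemma union_bound_card (R : realType) (disp : measure_display)
    (Omega : measurableType disp) (P : probability Omega R) (I : finType)
    (Q : {set I}) (F : I -> set Omega) (e : R) :
  (forall i, measurable (F i)) -> (forall i, (P (F i) <= e%:E)%E) ->
  measurable (\bigcup_(i in [set` Q]) F i) /\
  (P (\bigcup_(i in [set` Q]) F i) <= (#|Q|%:R * e)%:E)%E.
Proof.
move=> mF eF.
have := @union_bound _ _ _ P _ (enum Q) F (fun=> e) (fun i _ => mF i)
  (fun i _ => eF i).
rewrite big_const_seq count_predT -cardE iter_addr_0 mulr_natl.
by rewrite (_ : [set` enum Q] = [set` Q])//; apply/seteqP; split=> i /=;
  rewrite mem_enum.
Qed.

Lemma pow2_le_expR (R : realType) (n : nat) : (2 : R) ^+ n <= expR n%:R.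
Proof.
rewrite -[n%:R]mulr1 expRM_natl lerXn2r// ?nnegrE ?expR_ge0//.
by have := expR_ge1Dx (1 : R); lra.
Qed.

Lemma sqrt_le_self (R : realType) (x : R) : 1 <= x -> Num.sqrt x <= x.
Proof.
move=> x1; have x0 : 0 <= x by rewrite (le_trans _ x1).
by rewrite -[leRHS](ger0_norm x0) -sqrtr_sqr ler_wsqrtr// expr2; nra.
Qed.

(* 30 = 12 + 16 + 2: there are at most exp(12 2^n) links at level n, p <= 8 2^n
   makes exp(-16 v 2^n) <= exp(-2pv), and exp(-2 v 2^n) absorbs the factor 2 of
   the mixed tail and the sum over n. *)
Definition bad_links (R : realType) (T : finType) (Omega : Type)
    (V : normedModType R) (X : T -> Omega -> V) (d1 d2 : T -> T -> R)
    (rho : nat -> T -> T) (m M : nat) (v : R) : set Omega :=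
  \bigcup_(n in [set` index_iota m M])
    \bigcup_(x in [set` [set (rho n.+1 t, rho n t) | t : T]%SET])
      [set w | 30 * v * (Num.sqrt (2 ^+ n) * d2 x.1 x.2 + 2 ^+ n * d1 x.1 x.2)
               < `|X x.1 w - X x.2 w|].

Lemma bad_links_tail (R : realType) (disp : measure_display)
    (Omega : measurableType disp) (P : probability Omega R)
    (T : finType) (V : normedModType R) (X : T -> Omega -> V)
    (d1 d2 : T -> T -> R) (rho : nat -> T -> T) (m M : nat) (p v : R) :
  semimetric d1 -> semimetric d2 ->
  (forall s t : T, measurable_fun [set: Omega] (fun w => `|X t w - X s w|)) ->
  mixed_tail P X d1 d2 ->
  (forall n, (#|[set rho n t | t : T]%SET| <= 2 ^ 2 ^ n.+2)%N) ->
  p <= 2 ^+ m.+3 -> 1 <= v ->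
  measurable (bad_links X d1 d2 rho m M v) /\
  (P (bad_links X d1 d2 rho m M v) <= (expR (- (2 * p * v)))%:E)%E.
Proof.
move=> [d10 _ _ _] [d20 _ _ _] mX tX card_rho pm v1.
pose F n (x : T * T) :=
  [set w | 30 * v * (Num.sqrt (2 ^+ n) * d2 x.1 x.2 + 2 ^+ n * d1 x.1 x.2)
           < `|X x.1 w - X x.2 w|].
pose Q n := [set (rho n.+1 t, rho n t) | t : T]%SET.
have mF n x : measurable (F n x) by apply: measurable_gt; exact: mX.
(* The mixed tail at parameter [30 * v * 2 ^+ n]: as [30 * v >= 1], writing it in place of its
   square root only raises the threshold. *)
have PF n x : (P (F n x) <= (2 * expR (- (30 * v * 2 ^+ n)))%:E)%E.
  have n1 : 1 <= (2 : R) ^+ n by rewrite exprn_ege1// ler1n.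
  have u0 : 0 <= 30 * v * 2 ^+ n by nra.
  apply: le_trans (tX x.2 x.1 _ u0).
  apply: le_measure; rewrite ?inE; [exact: mF|exact: measurable_gt|].
  move=> w /=; apply: le_lt_trans; rewrite mulrDr lerD//.
    rewrite sqrtrM ?[leRHS]mulrA; last by lra.
    by rewrite ler_wpM2r// ler_wpM2r ?sqrtr_ge0// sqrt_le_self//; lra.
  by rewrite mulrA.
have PQ n := union_bound_card (Q n) (mF n) (PF n).
have [mB PB] := @union_bound _ _ _ P _ (index_iota m M) _ _
    (fun n _ => (PQ n).1) (fun n _ => (PQ n).2); split=> //.
apply: le_trans PB _; rewrite lee_fin.
(* Level [n] is allotted the fraction [2^-(n+1)] of the total probability. *)
apply: (@le_trans _ _ (\sum_(m <= n < M) expR (- (2 * p * v)) * (2^-1 * 2^-1 ^+ n))).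
  rewrite !big_nat ler_sum// => n /andP[mn _].
  (* A link pairs a value of [rho n.+1] with one of [rho n], and [2^(n+3) + 2^(n+2) = 12 * 2^n]. *)
  have cQ : #|Q n|%:R <= expR (12 * 2 ^+ n) :> R.
    have -> : 12 * 2 ^+ n = (12 * 2 ^ n)%:R :> R by rewrite natrM natrX.
    apply: le_trans (pow2_le_expR _ _); rewrite -natrX ler_nat.
    have -> : (2 ^ (12 * 2 ^ n) = 2 ^ 2 ^ n.+3 * 2 ^ 2 ^ n.+2)%N.
      by rewrite -expnD; congr expn; rewrite !expnS; lia.
    apply: leq_trans (leq_mul (card_rho n.+1) (card_rho n)).
    rewrite -finset.cardsX; apply/subset_leq_card/fintype.subsetP.
    by move=> _ /imsetP[t _ ->]; rewrite finset.in_setX !imset_f.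
  have e2 : 2 <= expR 1 :> R by have := expR_ge1Dx (1 : R); lra.
  rewrite -exprS exprVn.
  apply: (@le_trans _ _ (expR (- (2 * p * v)) * expR (- n.+1%:R))); last first.
    rewrite ler_wpM2l ?expR_ge0// expRN lef_pV2 ?posrE ?expR_gt0 ?exprn_gt0//.
    exact: pow2_le_expR.
  apply: (@le_trans _ _ (expR (12 * 2 ^+ n) * (expR 1 * expR (- (30 * v * 2 ^+ n))))).
    rewrite ler_pM ?mulr_ge0 ?expR_ge0//.
    by rewrite ler_wpM2r ?expR_ge0.
  rewrite -!expRD ler_expR.
  have N1 : n.+1%:R <= 2 ^+ n :> R by rewrite -natrX ler_nat ltn_expl.
  have pn : p <= 8 * 2 ^+ n.
    apply: le_trans pm _; have -> : 8 = 2 ^+ 3 :> R by rewrite -natrX.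
    by rewrite -exprD ler_eXn2l ?ltr1n//; lia.
  have N0 : 1 <= (2 : R) ^+ n by rewrite exprn_ege1// ler1n.
  have pv : p * v <= 8 * 2 ^+ n * v by rewrite ler_wpM2r//; lra.
  have Nv : 2 ^+ n <= 2 ^+ n * v by rewrite ler_peMr//; lra.
  lra.
rewrite -mulr_sumr -[leRHS]mulr1 ler_wpM2l ?expR_ge0// -mulr_sumr.
apply: (@le_trans _ _ (2^-1 * 2)); last by rewrite mulVf.
rewrite ler_wpM2l//; apply: le_trans (sum_geometric_half_le R M).
have [mM|Mm] := leqP m M; last first.
  by rewrite big_geq ?(ltnW Mm)// sumr_ge0// => i _; rewrite exprn_ge0.
rewrite [leRHS](big_cat_nat (leq0n m) mM)/= lerDr sumr_ge0// => i _.
Qed.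

(** * Optimal admissible sequences *)

(* Replacing [A n] by the whole of [T] once [#|T| < n] keeps a sequence
   admissible and decreases the chaining sums, so the infimum is over finitely
   many sequences. *)
Lemma gamma_functional_attained (R : realType) (T : finType) (alpha : R)
    (d : T -> T -> R) (t0 : T) :
  semimetric d -> exists2 A, admissible A &
  forall t n, ((\sum_(0 <= k < n) 2 `^ (k%:R / alpha) * dist_set d t (A k))%:E
               <= gamma_functional alpha d)%E.
Proof.
move=> [d0 dxx _ _].
pose term (A : nat -> {set T}) t n : \bar R :=
  (2 `^ (n%:R / alpha) * dist_set d t (A n))%:E.
have term0 A t n : (0 <= term A t n)%E.
  by rewrite lee_fin mulr_ge0 ?powR_ge0 ?dist_set_ge0.
pose G A := ereal_sup (range (fun t => (\sum_(0 <= n <oo) term A t n)%E)).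
pose N := #|T|.+1.
pose ext (f : {ffun 'I_N -> {set T}}) n : {set T} :=
  if insub n is Some i then f i else [set: T]%SET.
have extP (f : {ffun 'I_N -> {set T}}) : (forall i, f i != finset.set0) ->
    (forall i : 'I_N, if i == 0%N :> nat then #|f i| = 1%N
               else (#|f i| <= 2 ^ 2 ^ i)%N) -> admissible (ext f).
  move=> f0 fc; split=> [n||n n0]; rewrite /ext.
  - by case: insubP => // _; apply/set0Pn; exists t0.
  - by case: insubP => //= i _ i0; have := fc i; rewrite i0.
  - case: insubP => [i _ /= ni|]; first by have := fc i; rewrite ni gtn_eqF.
    rewrite -leqNgt cardsT => Nn; apply: leq_trans (ltnW Nn) _.
    apply: leq_trans (ltnW (ltn_expl n (ltnSn 1))) _; rewrite leq_exp2l//.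
    exact/ltnW/ltn_expl.
have cut A : admissible A -> exists2 f, admissible (ext f) & (G (ext f) <= G A)%E.
  move=> [A0 A1 AS]; exists [ffun i : 'I_N => A i].
    apply: extP => i; rewrite !ffunE//.
    by case: i => -[|i] Hi//=; apply: AS.
  apply: ge_ereal_sup => _ [t _ <-].
  apply: le_trans (ereal_sup_ubound _); last by exists t.
  apply: lee_nneseries => [n _ _|n _]; first exact: term0.
  rewrite lee_fin ler_wpM2l ?powR_ge0// /ext.
  case: insubP => [i _ <-|_]; first by rewrite ffunE.
  (* Beyond the cut the set is all of [T], which contains [t] at distance [d t t = 0]. *)
  apply: le_trans (dist_set_ge0 _ _ d0).
  by rewrite -(dxx t); apply: ge_inf; [exists 0 => _ [s _ <-]|exists t => //=;
    rewrite finset.in_setT].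
(* The constant sequence [{t0}] shows that the minimum is over a nonempty family. *)
have [f0 Pf0] : exists f, `[< admissible (ext f) >].
  have /cut[f adf _] : admissible (fun=> [set t0]%SET); last first.
    by exists f; apply/asboolP.
  split=> [n||n _]; rewrite ?cards1 ?expn_gt0//.
  by apply/set0Pn; exists t0; rewrite finset.in_set1.
have [f /asboolP adf fmin] :=
  @arg_minP _ _ _ f0 (fun f => `[< admissible (ext f) >]) (fun f => G (ext f)) Pf0.
exists (ext f) => // t n.
apply: (@le_trans _ _ (G (ext f))); last first.
  (* By [cut], a minimiser among truncated sequences is one among all admissible sequences. *)
  apply: le_ereal_inf_tmp => _ [A adA <-]; have [f' adf' f'A] := cut A adA.
  by apply: le_trans f'A; apply: fmin; apply/asboolP.
apply: le_trans (ereal_sup_ubound _); last by exists t.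
apply: le_trans (nneseries_lim_ge n _); last by move=> k _ _; exact: term0.
by rewrite -sumEFin.
Qed.

(** * From tails to moments; finite maxima *)

(** Slicing at the heights [a * k] bounds [W^p] by the sum of [(a * (k+1))^p] over the slices
    reached. As [k + 1 <= exp k], slice [k] contributes at most [a^p * exp(-p k) <= a^p / 2^k], and
    the total [2 * a^p] is at most [(2 * a)^p] because [p >= 1]. *)
Lemma moment_le_of_tail (R : realType) (disp : measure_display)
    (Omega : measurableType disp) (P : probability Omega R) (W : Omega -> R)
    (p a : R) :
  1 <= p -> 0 < a -> measurable_fun [set: Omega] W -> (forall w, 0 <= W w) ->
  (forall k : nat, (0 < k)%N ->
     (P [set w | (a * k%:R < W w)%R] <= (expR (- (2 * p * k%:R)))%:E)%E) ->
  (\int[P]_w (W w `^ p)%:E <= ((2 * a) `^ p)%:E)%E.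
Proof.
move=> p1 a0 mW W0 tW; have p0 : 0 <= p by lra.
(* Slice 0 is the whole space, whose bound [exp 0 = 1] is trivial; the tail is assumed only for
   [k > 0]. *)
pose F k := if k is 0%N then [set: Omega] else [set w | a * k%:R < W w].
have mF k : measurable (F k) by case: k => [|k] //=; exact: measurable_gt.
have PF k : (P (F k) <= (expR (- (2 * p * k%:R)))%:E)%E.
  case: k => [|k]; last exact: tW.
  by rewrite mulr0 oppr0 expR0; exact: probability_le1.
pose c k := (a * k.+1%:R) `^ p.
have c0 k : 0 <= c k by exact: powR_ge0.
pose h k : Omega -> R := fun w => c k * \1_(F k) w.
have mh k : measurable_fun [set: Omega] (EFin \o h k).
  by apply/measurable_EFinP; apply: measurable_funM => //; exact: measurable_indic.
have h0 k w : (0 <= (h k w)%:E)%E by rewrite lee_fin mulr_ge0.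
apply: (@le_trans _ _ (\int[P]_w (\sum_(0 <= k <oo) (h k w)%:E))%E).
  apply: ge0_le_integral => //.
  - by move=> w _; rewrite lee_fin powR_ge0.
  - by apply/measurable_EFinP; apply: (measurableT_comp (measurable_powR p)).
  - exact: (@ge0_emeasurable_sum _ _ _ _ (fun k => EFin \o h k) xpredT
      (fun k w _ _ => h0 k w) (fun k _ => mh k)).
  move=> w _.
  (* The least [k] with [W w <= a * (k+1)]: if positive, its minimality gives [a * k < W w]. *)
  have [k Fk Wk] : exists2 k, F k w & W w <= a * k.+1%:R.
    have ex : exists k, W w <= a * k.+1%:R.
      exists (Num.truncn (W w / a)).
      by rewrite mulrC -ler_pdivrMr// ltW// truncnS_gt.
    case: (ex_minnP ex) => -[|k] Wk kmin; first by exists 0%N.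
    exists k.+1 => //=; rewrite ltNge; apply/negP => /kmin.
    by rewrite ltnn.
  apply: le_trans (nneseries_lim_ge k.+1 _); last by move=> i _ _; exact: h0.
  rewrite big_nat_recr//= -[leLHS]add0e leeD//; first exact: sume_ge0.
  by rewrite /h indicE mem_set// mulr1 lee_fin ge0_ler_powR// nnegrE// mulr_ge0// ltW.
rewrite integral_nneseries//.
apply: lime_le; first by apply: is_cvg_nneseries => n _ _; exact: integral_ge0.
apply: nearW => n.
apply: (@le_trans _ _ (\sum_(0 <= k < n) a `^ p * 2^-1 ^+ k)%:E).
  rewrite -sumEFin; apply: lee_sum => k _.
  under eq_integral do rewrite /h EFinM.
  rewrite ge0_integralZl_EFin//; last first.
    by apply/measurable_EFinP; exact: measurable_indic.
  rewrite integral_indic// setIT.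
  apply: (@le_trans _ _ ((c k)%:E * (expR (- (2 * p * k%:R)))%:E)%E).
    by apply: lee_wpmul2l; [rewrite lee_fin|exact: PF].
  have a0' := ltW a0.
  rewrite -EFinM lee_fin /c powRM// -[leLHS]mulrA ler_wpM2l ?powR_ge0//.
  apply: (@le_trans _ _ (expR (k%:R * p) * expR (- (2 * p * k%:R)))).
    rewrite ler_wpM2r ?expR_ge0// expRM ge0_ler_powR ?nnegrE ?expR_ge0//.
    by have := expR_ge1Dx (k%:R : R); rewrite -natr1 addrC.
  rewrite -expRD exprVn.
  apply: (@le_trans _ _ (expR (- k%:R))).
    rewrite ler_expR; have : 0 <= k%:R :> R by []. 
    nra.
  rewrite expRN lef_pV2 ?posrE ?expR_gt0 ?exprn_gt0//.
  exact: pow2_le_expR.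
have a0' := ltW a0; rewrite lee_fin -mulr_sumr powRM// mulrC ler_wpM2r ?powR_ge0//.
apply: le_trans (sum_geometric_half_le R n) _.
rewrite -[leLHS](powRr1) //.
by rewrite ler_powR// ler1n.
Qed.

(** Turns the real supremum into a finite maximum, convenient for measurability and bounds. The
    default 0 does not change the value since [f] is nonnegative and [t0] inhabits [T]. *)
Lemma sup_range_bigmax (R : realType) (T : finType) (f : T -> R) (t0 : T) :
  (forall t, 0 <= f t) -> sup (range f) = \big[Num.max/0]_t f t.
Proof.
move=> f0; have ubf : ubound (range f) (\big[Num.max/0]_t f t).
  by move=> _ [t _ <-]; exact: le_bigmax.
have f_le t : f t <= sup (range f).
  by apply: ub_le_sup; [exists (\big[Num.max/0]_t f t)|exists t].
apply/eqP; rewrite eq_le ge_sup//=; last by exists (f t0), t0.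
by apply: bigmax_le => [|t _]; [exact: le_trans (f0 t0) (f_le t0)|exact: f_le].
Qed.

Lemma measurable_bigmax (R : realType) (disp : measure_display)
    (Omega : measurableType disp) (I : Type) (s : seq I) (f : I -> Omega -> R) :
  (forall i, measurable_fun [set: Omega] (f i)) ->
  measurable_fun [set: Omega] (fun w => \big[Num.max/0]_(i <- s) f i w).
Proof.
move=> mf; elim: s => [|i s IH].
  by under eq_fun do rewrite big_nil; exact: measurable_cst.
by under eq_fun do rewrite big_cons; exact: measurable_maxr.
Qed.

(** The maximum is one of the values or the default 0; [p != 0] makes the power of that default
    vanish. *)
Lemma powR_bigmax_le_sum (R : realType) (I : Type) (s : seq I) (f : I -> R)
    (p : R) :
  p != 0 -> (\big[Num.max/0]_(i <- s) f i) `^ p <= \sum_(i <- s) f i `^ p.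
Proof.
move=> p0; elim: s => [|i s IH]; first by rewrite !big_nil powR0.
rewrite !big_cons; have [_|_] := leP (f i) (\big[Num.max/0]_(j <- s) f j).
  by apply: le_trans IH _; rewrite lerDr powR_ge0.
by rewrite lerDl sumr_ge0// => j _; rewrite powR_ge0.
Qed.

Lemma le_diameter (R : realType) (T : finType) (d : T -> T -> R) (s t : T) :
  d s t <= diameter d.
Proof.
apply: ub_le_sup; last by exists s => //; exists t.
exists (\big[Num.max/0]_(x : T * T) d x.1 x.2) => _ [x _ [y _ <-]].
exact: (le_bigmax _ (fun x : T * T => d x.1 x.2) (x, y)).
Qed.

(** * Chaining above the level of p *)

(** Minimising sequences for both functionals feed [joint_chain]. All weights are at least 1, so
    each single distance is bounded by the whole sum; this supplies the top scales [g1] and [g2] of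
    the cells. *)
Lemma gamma_chain (R : realType) (T : finType) (d1 d2 : T -> T -> R)
    (g1 g2 : R) (t0 : T) :
  semimetric d1 -> semimetric d2 ->
  gamma_functional 1 d1 = g1%:E -> gamma_functional 2 d2 = g2%:E ->
  [/\ 0 <= g1, 0 <= g2 & exists rho : nat -> T -> T,
    [/\ #|[set rho 0%N t | t : T]%SET| = 1%N,
        forall n, (#|[set rho n t | t : T]%SET| <= 2 ^ 2 ^ n.+2)%N,
        forall n t, (#|T| < n)%N -> rho n t = t &
        forall m M t, \sum_(m <= n < M)
          (Num.sqrt (2 ^+ n) * d2 (rho n.+1 t) (rho n t)
           + 2 ^+ n * d1 (rho n.+1 t) (rho n t)) <= 10 * (g2 + g1)]].
Proof.
move=> sd1 sd2 Eg1 Eg2.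
have [A adA] := gamma_functional_attained 2 t0 sd2; rewrite Eg2 => gA.
have [B adB] := gamma_functional_attained 1 t0 sd1; rewrite Eg1 => gB.
have w2E n : 2 `^ (n%:R / 2) = Num.sqrt (2 ^+ n) :> R.
  by rewrite powRrM powR_mulrn// powR12_sqrt// exprn_ge0.
have w1E n : 2 `^ (n%:R / 1) = 2 ^+ n :> R by rewrite divr1 powR_mulrn.
have {}gA t n : \sum_(0 <= k < n) Num.sqrt (2 ^+ k) * dist_set d2 t (A k) <= g2.
  by under eq_bigr do rewrite -w2E; rewrite -lee_fin.
have {}gB t n : \sum_(0 <= k < n) 2 ^+ k * dist_set d1 t (B k) <= g1.
  by under eq_bigr do rewrite -w1E; rewrite -lee_fin.
have p1 n : 1 <= (2 : R) ^+ n by rewrite exprn_ege1// ler1n.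
have s1 n : 1 <= Num.sqrt ((2 : R) ^+ n) by rewrite -[leLHS]sqrtr1 ler_wsqrtr.
have D20 t n : 0 <= dist_set d2 t (A n) by case: sd2 => *; exact: dist_set_ge0.
have D10 t n : 0 <= dist_set d1 t (B n) by case: sd1 => *; exact: dist_set_ge0.
have term_le (w D : nat -> R) g n : (forall k, 1 <= w k) -> (forall k, 0 <= D k) ->
    \sum_(0 <= k < n.+1) w k * D k <= g -> D n <= g.
  move=> w1 D0; apply: le_trans; rewrite big_nat_recr//=.
  rewrite -[leLHS]add0r lerD ?sumr_ge0// => [k _|].
    by rewrite mulr_ge0// (le_trans _ (w1 k)).
  by rewrite ler_peMl.
have [rho [c0 cn idr r2 r1]] : _ :=
  joint_chain t0 sd1 sd2 adA adB
   (fun n t => term_le _ (fun k => dist_set d2 t (A k)) _ n s1 (D20 t) (gA t n.+1))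
   (fun n t => term_le _ (fun k => dist_set d1 t (B k)) _ n p1 (D10 t) (gB t n.+1)).
have g20 : 0 <= g2 by have := gA t0 0%N; rewrite big_nil.
have g10 : 0 <= g1 by have := gB t0 0%N; rewrite big_nil.
split=> //; exists rho; split=> // m M t; rewrite big_split/= mulrDr lerD//.
  apply: (chain_sum_le m M sd2 (w := fun n => Num.sqrt (2 ^+ n)) (t := t)
    (D := fun n => dist_set d2 t (A n))) => //.
    by move=> n; rewrite sqrtr_ge0 sqrt_le_self.
  by move=> i j ij; rewrite ler_wsqrtr// ler_weXn2l// ler1n.
apply: (chain_sum_le m M sd1 (w := fun n => 2 ^+ n) (t := t)
    (D := fun n => dist_set d1 t (B n))) => //.
  by move=> n; rewrite lexx exprn_ge0.
by move=> i j ij; rewrite ler_weXn2l// ler1n.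
Qed.

Lemma norm_link_sum (R : realType) (V : normedModType R) (x : nat -> V)
    (m M : nat) :
  (m <= M)%N -> `|x M - x m| <= \sum_(m <= n < M) `|x n.+1 - x n|.
Proof. by move=> mM; rewrite -telescope_sumr// ler_norm_sum. Qed.

Lemma not_bad_links (R : realType) (T : finType) (Omega : Type)
    (V : normedModType R) (X : T -> Omega -> V) (d1 d2 : T -> T -> R)
    (rho : nat -> T -> T) (m M : nat) (v g : R) (t : T) (w : Omega) :
  (m <= M)%N -> rho M t = t -> 0 <= v ->
  \sum_(m <= n < M) (Num.sqrt (2 ^+ n) * d2 (rho n.+1 t) (rho n t)
                     + 2 ^+ n * d1 (rho n.+1 t) (rho n t)) <= g ->
  ~ bad_links X d1 d2 rho m M v w ->
  `|X t w - X (rho m t) w| <= 30 * v * g.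
Proof.
move=> mM rM v0 sg ok; rewrite -{1}rM.
apply: le_trans (norm_link_sum (fun n => X (rho n t) w) mM) _.
apply: (@le_trans _ _ (30 * v * \sum_(m <= n < M)
    (Num.sqrt (2 ^+ n) * d2 (rho n.+1 t) (rho n t)
     + 2 ^+ n * d1 (rho n.+1 t) (rho n t)))); last first.
  by rewrite ler_wpM2l// mulr_ge0.
rewrite mulr_sumr !big_nat ler_sum// => n mnM; rewrite leNgt; apply/negP => lt.
apply: ok; exists n; first by rewrite /= mem_index_iota.
by exists (rho n.+1 t, rho n t) => //=; exact: imset_f.
Qed.

(** The least level satisfying the upper bound. That bound serves the union over links, while the
    lower one limits the number of starting points. *)
Lemma chain_level (R : realType) (p : R) : 1 <= p ->
  exists m, (m = 0%N \/ 2 ^+ m.+2 <= p) /\ p <= 2 ^+ m.+3.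
Proof.
move=> p1; have ex : exists m, p <= 2 ^+ m.+3.
  exists (Num.truncn p); apply: le_trans (ltW (truncnS_gt p)) _.
  by rewrite -natrX ler_nat (leq_trans (ltn_expl _ (ltnSn 1)))// leq_exp2l// -addn3 leq_addr.
case: (ex_minnP ex) => m pm mmin; exists m; split => //.
case: m pm mmin => [|m] _ mmin; [by left|right].
by rewrite leNgt; apply/negP => /ltW/mmin; rewrite ltnn.
Qed.

(** Common source of both bounds. The map [r] is fixed before [v], so that the same increments can
    be tested at every [v = k] for the moments; the tail bound takes [v = 1]. *)
Lemma chain_above_level (R : realType) (disp : measure_display)
    (Omega : measurableType disp) (P : probability Omega R) (T : finType)
    (d1 d2 : T -> T -> R) (V : normedModType R) (X : T -> Omega -> V)
    (g1 g2 : R) (t0 : T) (p : R) :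
  semimetric d1 -> semimetric d2 ->
  (forall s t : T, measurable_fun [set: Omega] (fun w => `|X t w - X s w|)) ->
  mixed_tail P X d1 d2 ->
  gamma_functional 1 d1 = g1%:E -> gamma_functional 2 d2 = g2%:E -> 1 <= p ->
  exists r : T -> T, #|[set r t | t : T]%SET|%:R <= 2 `^ p /\
    forall v, 1 <= v -> exists E : set Omega,
      [/\ measurable E, (P E <= (expR (- (2 * p * v)))%:E)%E &
        forall w t, ~ E w -> `|X t w - X (r t) w| <= 300 * (g2 + g1) * v].
Proof.
move=> sd1 sd2 mX tX Eg1 Eg2 p1.
have [g10 g20 [rho [c0 cn idr sum_le]]] := gamma_chain t0 sd1 sd2 Eg1 Eg2.
have [m [mp pm]] := chain_level p1.
exists (rho m); split.
  case: mp => [->|mp]; first by rewrite c0 -[leLHS](powRr0 2) ler_powR// ?ler1n//; lra.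
  apply: (@le_trans _ _ (2 ^ 2 ^ m.+2)%:R); first by rewrite ler_nat.
  by rewrite natrX -powR_mulrn// ler_powR ?ler1n// natrX.
move=> v v1.
(* The chain stops at a level above [#|T|], where [rho] is the identity. *)
have [mE PE] := bad_links_tail (maxn m #|T|.+1) sd1 sd2 mX tX cn pm v1.
exists (bad_links X d1 d2 rho m (maxn m #|T|.+1) v); split=> // w t nE.
have -> : 300 * (g2 + g1) * v = 30 * v * (10 * (g2 + g1)) by ring.
apply: (@not_bad_links _ _ _ _ _ d1 d2 rho m (maxn m #|T|.+1)) => //.
- exact: leq_maxl.
- by apply: idr; rewrite leq_max ltnSn orbT.
- by lra.
Qed.

(** * The tail bound *)

Lemma chaining_tail (R : realType) (disp : measure_display)
    (Omega : measurableType disp) (P : probability Omega R) (T : finType)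
    (d1 d2 : T -> T -> R) (V : normedModType R) (X : T -> Omega -> V)
    (g1 g2 : R) (t0 : T) (u : R) :
  semimetric d1 -> semimetric d2 ->
  (forall s t : T, measurable_fun [set: Omega] (fun w => `|X t w - X s w|)) ->
  mixed_tail P X d1 d2 ->
  gamma_functional 1 d1 = g1%:E -> gamma_functional 2 d2 = g2%:E -> 1 <= u ->
  (P [set w | (300 * (g2 + g1) + 4 * (Num.sqrt u * diameter d2 + u * diameter d1)
               < sup (range (fun t => `|X t w - X t0 w|)))%R]
   <= (expR (- u))%:E)%E.
Proof.
move=> sd1 sd2 mX tX Eg1 Eg2 u1.
have [r [cr /(_ 1 (lexx 1))[E [mE PE nE]]]] :=
  chain_above_level t0 sd1 sd2 mX tX Eg1 Eg2 u1.
(* Parameter [4 * u] leaves room for at most [2^u] starting points: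
   [exp u * exp(1 - 4u) <= exp(-2u)] for [u >= 1]. *)
pose F s := [set w | Num.sqrt (4 * u) * d2 s t0 + 4 * u * d1 s t0
                     < `|X s w - X t0 w|].
have mF s : measurable (F s) by apply: measurable_gt; exact: mX.
have u40 : 0 <= 4 * u by lra.
have u0 : 0 <= u by lra.
have [g10 g20 _] := gamma_chain t0 sd1 sd2 Eg1 Eg2.
have D20 : 0 <= diameter d2.
  by case: sd2 => d0 _ _ _; apply: le_trans (le_diameter d2 t0 t0).
have D10 : 0 <= diameter d1.
  by case: sd1 => d0 _ _ _; apply: le_trans (le_diameter d1 t0 t0).
have [mU PU] := union_bound_card (P := P) [set r t | t : T]%SET mF
  (fun s => tX t0 s _ u40).
set U := \bigcup_(_ in _) _ in mU PU.
have mS : measurable [set w | (300 * (g2 + g1)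
    + 4 * (Num.sqrt u * diameter d2 + u * diameter d1)
    < sup (range (fun t => `|X t w - X t0 w|)))%R].
  apply: measurable_gt; under eq_fun do rewrite (sup_range_bigmax t0)//.
  by apply: measurable_bigmax => t; exact: mX.
apply: (@le_trans _ _ (P (E `|` U))).
  apply: le_measure; rewrite ?inE//; first exact: measurableU.
  move=> w /=; rewrite ltNge => /negP nle; apply: contrapT => /not_orP[nEw nUw].
  apply: nle; rewrite (sup_range_bigmax t0)//.
  have S0 : 0 <= 300 * (g2 + g1) + 4 * (Num.sqrt u * diameter d2 + u * diameter d1).
    have D0 := addr_ge0 (mulr_ge0 (sqrtr_ge0 u) D20) (mulr_ge0 u0 D10).
    by move: g10 g20 D0; lra.
  apply: bigmax_le => // t _; rewrite -(subrKA (X (r t) w)).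
  apply: le_trans (ler_normD _ _) _; rewrite lerD//.
    by have := nE w t nEw; rewrite mulr1.
  apply: (@le_trans _ _ (Num.sqrt (4 * u) * d2 (r t) t0 + 4 * u * d1 (r t) t0)).
    rewrite leNgt; apply/negP => lt; apply: nUw; exists (r t) => //=.
    exact: imset_f.
  have -> : Num.sqrt (4 * u) = 2 * Num.sqrt u.
    have -> : 4 = 2 ^+ 2 :> R by rewrite -natrX.
    by rewrite sqrtrM ?exprn_ge0// sqrtr_sqr ger0_norm.
  have := ler_wpM2l (sqrtr_ge0 u) (le_diameter d2 (r t) t0).
  have := ler_wpM2l u0 (le_diameter d1 (r t) t0).
  by have := mulr_ge0 (sqrtr_ge0 u) D20; lra.
apply: le_trans (measureU2 _ mE mU) _.
apply: le_trans (leeD PE PU) _; rewrite -EFinD lee_fin mulr1.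
have e2 : 2 <= expR 1 :> R by have := expR_ge1Dx (1 : R); lra.
have cE : #|[set r t | t : T]%SET|%:R * (2 * expR (- (4 * u))) <= expR (- (2 * u)).
  apply: (@le_trans _ _ (expR u * (expR 1 * expR (- (4 * u))))).
    rewrite ler_pM ?mulr_ge0 ?expR_ge0//; last by rewrite ler_wpM2r ?expR_ge0.
    apply: le_trans cr _; rewrite -[u in leRHS]mul1r expRM.
    by rewrite ge0_ler_powR ?nnegrE ?expR_ge0//; lra.
  by rewrite -!expRD ler_expR; lra.
apply: le_trans (lerD (lexx _) cE) _.
(* Both events have probability at most [exp(-2u)], and [2 <= exp 1 <= exp u]. *)
apply: (@le_trans _ _ (expR 1 * expR (- (2 * u)))).
  by have := expR_ge0 (- (2 * u)); nra.
by rewrite -expRD ler_expR; lra.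
Qed.

(** * The moment bound *)

Lemma Lnorm_powR (R : realType) (disp : measure_display)
    (Omega : measurableType disp) (P : probability Omega R) (f : Omega -> R)
    (p : R) :
  (forall w, 0 <= f w) ->
  Lnorm P p%:E (EFin \o f) = ((\int[P]_w (f w `^ p)%:E) `^ p^-1)%E.
Proof.
move=> f0; rewrite Lnorm.unlock.
apply: (congr1 (fun x => x `^ p^-1)%E).
apply: eq_integral => w _.
by rewrite /= ger0_norm.
Qed.

Lemma le_poweR (R : realType) (x y : \bar R) (p : R) :
  0 <= p -> (0 <= x)%E -> (x <= y)%E -> (x `^ p <= y `^ p)%E.
Proof.
move=> p0 x0 xy; apply: gt0_ler_poweR => //; rewrite in_itv/= leey andbT//.
exact: le_trans xy.
Qed.

(** The power of the maximum is at most the sum of the powers, which costs a factor [size s <= 2^p];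
    its p-th root is the factor 2 of the theorem. *)
Lemma Lnorm_bigmax_le (R : realType) (disp : measure_display)
    (Omega : measurableType disp) (P : probability Omega R) (I : Type)
    (s : seq I) (f : I -> Omega -> R) (p : R) (S : \bar R) :
  1 <= p -> (forall i, measurable_fun [set: Omega] (f i)) ->
  (forall i w, 0 <= f i w) -> (size s)%:R <= 2 `^ p :> R ->
  (forall i, ((\int[P]_w (f i w `^ p)%:E) `^ p^-1 <= S)%E) -> (0 <= S)%E ->
  ((\int[P]_w ((\big[Num.max/0]_(i <- s) f i w) `^ p)%:E) `^ p^-1
   <= 2%:E * S)%E.
Proof.
move=> p1 mf f0 sp fS S0; have p0 : 0 < p by lra.
have mfp i : measurable_fun [set: Omega] (fun w => (f i w `^ p)%:E : \bar R).
  apply/measurable_EFinP; exact: (measurableT_comp (measurable_powR p)).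
have int0 (h : Omega -> R) : (0 <= \int[P]_w (h w `^ p)%:E)%E.
  by apply: integral_ge0 => w _; rewrite lee_fin powR_ge0.
have cancel (x : \bar R) : (0 <= x)%E -> ((x `^ p) `^ p^-1 = x)%E.
  by move=> x0; rewrite -poweRrM mulfV ?gt_eqF// poweRe1.
have fSp i : (\int[P]_w (f i w `^ p)%:E <= S `^ p)%E.
  rewrite -[leLHS]poweRe1// -(@mulVf _ p) ?gt_eqF// poweRrM.
  by apply: le_poweR => //; [exact: ltW|exact: poweR_ge0].
rewrite -[leRHS]cancel ?mule_ge0//.
apply: le_poweR => //; first by rewrite invr_ge0 ltW.
apply: (@le_trans _ _ (\int[P]_w (\sum_(i <- s) (f i w `^ p)%:E))%E).
  apply: ge0_le_integral => //.
  - by move=> w _; rewrite lee_fin powR_ge0.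
  - apply/measurable_EFinP; apply: (measurableT_comp (measurable_powR p)).
    exact: measurable_bigmax.
  - exact: emeasurable_sum.
  - move=> w _; rewrite sumEFin lee_fin; apply: powR_bigmax_le_sum.
    by rewrite gt_eqF.
rewrite ge0_integral_sum//; last by move=> i w _; rewrite lee_fin powR_ge0.
apply: (@le_trans _ _ (\sum_(i <- s) S `^ p)%E).
  by apply: lee_sum => i _.
rewrite big_const_seq count_predT poweRM//.
have -> : (iter (size s) (adde (S `^ p)) 0 = (size s)%:R%:E * S `^ p)%E.
  by rewrite iter_addr_0 mule_natl.
by apply: lee_wpmul2r; [exact: poweR_ge0|rewrite poweR_EFin lee_fin].
Qed.

Lemma chaining_moment (R : realType) (disp : measure_display)
    (Omega : measurableType disp) (P : probability Omega R) (T : finType)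
    (d1 d2 : T -> T -> R) (V : normedModType R) (X : T -> Omega -> V)
    (g1 g2 : R) (t0 : T) (p : R) :
  semimetric d1 -> semimetric d2 ->
  (forall s t : T, measurable_fun [set: Omega] (fun w => `|X t w - X s w|)) ->
  mixed_tail P X d1 d2 ->
  gamma_functional 1 d1 = g1%:E -> gamma_functional 2 d2 = g2%:E -> 1 <= p ->
  ('E_P[fun w => sup (range (fun t => (`|X t w - X t0 w| `^ p)%R))] `^ (p^-1)
   <= (600 * (g2 + g1))%:E + 2%:E * ereal_sup (range (fun t =>
        'E_P[fun w => (`|X t w - X t0 w| `^ p)%R] `^ (p^-1))))%E.
Proof.
move=> sd1 sd2 mX tX Eg1 Eg2 p1.
have [g10 g20 _] := gamma_chain t0 sd1 sd2 Eg1 Eg2.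
have [r [cr tail]] := chain_above_level t0 sd1 sd2 mX tX Eg1 Eg2 p1.
set S := ereal_sup _; have p0 : 0 < p by lra.
(* [W] collects the increments above the level and [Y] those from the starting points to [t0];
   pointwise the supremum is at most [W + Y]. *)
pose W w := \big[Num.max/0]_t `|X t w - X (r t) w|.
pose Y w := \big[Num.max/0]_(s <- enum [set r t | t : T]%SET) `|X s w - X t0 w|.
have mW : measurable_fun [set: Omega] W by apply: measurable_bigmax => t; exact: mX.
have mY : measurable_fun [set: Omega] Y by apply: measurable_bigmax => t; exact: mX.
have W0 w : 0 <= W w by exact: bigmax_ge_id.
have Y0 w : 0 <= Y w by exact: bigmax_ge_id.
have S_ub t : ((\int[P]_w (`|X t w - X t0 w| `^ p)%:E) `^ p^-1 <= S)%E.
  by apply: ereal_sup_ubound; exists t => //; rewrite unlock.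
have YS : (Lnorm P p%:E (EFin \o Y) <= 2%:E * S)%E.
  rewrite Lnorm_powR//; apply: Lnorm_bigmax_le => //.
    by rewrite -cardE.
  by apply: le_trans (S_ub t0); exact: poweR_ge0.
have WS : (Lnorm P p%:E (EFin \o W) <= (600 * (g2 + g1))%:E)%E.
  (* [moment_le_of_tail] requires [a > 0] while [g2 + g1] may vanish, so a slack [e] is added and
     then sent to 0. *)
  apply/lee_addgt0Pr => e e0; rewrite -EFinD Lnorm_powR//.
  pose a := 300 * (g2 + g1) + e / 2.
  have a0 : 0 < a by rewrite /a; lra.
  have -> : 600 * (g2 + g1) + e = 2 * a by rewrite /a; lra.
  have a20 : 0 <= 2 * a by lra.
  have -> : (2 * a)%:E = ((2 * a)%:E `^ p `^ p^-1)%E.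
    by rewrite -poweRrM mulfV ?gt_eqF// poweRe1.
  apply: le_poweR; first by rewrite invr_ge0 ltW.
    by apply: integral_ge0 => w _; rewrite lee_fin powR_ge0.
  rewrite poweR_EFin; apply: moment_le_of_tail => // k k0.
  have k1 : 1 <= k%:R :> R by rewrite ler1n.
  have [E [mE PE nE]] := tail _ k1; apply: le_trans PE.
  apply: le_measure; rewrite ?inE//; first exact: measurable_gt.
  move=> w /=; rewrite ltNge => /negP nle; apply: contrapT => nEw; apply: nle.
  apply: bigmax_le => [|t _]; first by rewrite mulr_ge0// ltW.
  by apply: le_trans (nE w t nEw) _; rewrite ler_wpM2r// /a; lra.
apply: le_trans (leeD WS YS); apply: le_trans (minkowski_EFin _ mW mY p1).
rewrite Lnorm_powR => [|w]; last by rewrite addr_ge0.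
rewrite unlock; apply: le_poweR; first by rewrite invr_ge0 ltW.
  apply: integral_ge0 => w _.
  rewrite lee_fin (sup_range_bigmax t0) ?bigmax_ge_id// => t; exact: powR_ge0.
apply: ge0_le_integral => //.
- move=> w _.
  rewrite lee_fin (sup_range_bigmax t0) ?bigmax_ge_id// => t; exact: powR_ge0.
- apply/measurable_EFinP; under eq_fun do rewrite (sup_range_bigmax t0)//.
  apply: measurable_bigmax => t.
  exact: (measurableT_comp (measurable_powR p)).
- apply/measurable_EFinP; apply: (measurableT_comp (measurable_powR p)).
  exact: measurable_funD.
move=> w _; rewrite lee_fin (sup_range_bigmax t0) => [|t]; last exact: powR_ge0.
apply: bigmax_le => [|t _]; first exact: powR_ge0.
apply: ge0_ler_powR; rewrite ?nnegrE ?addr_ge0//; first exact: ltW.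
rewrite -(subrKA (X (r t) w)); apply: le_trans (ler_normD _ _) _.
rewrite lerD//; first exact: (le_bigmax _ (fun t => `|X t w - X (r t) w|) t).
by apply: (le_bigmax_seq _ (r t) xpredT (fun s => `|X s w - X t0 w|)) => //;
  rewrite mem_enum imset_f.
Qed.

Theorem theorem3p5 (R : realType) :
  exists c C C' : R, [/\ 0 < c, 0 < C, 0 < C' &
  forall (disp : measure_display) (Omega : measurableType disp)
    (P : probability Omega R) (T : finType) (d1 d2 : T -> T -> R)
    (V : normedModType R) (X : T -> Omega -> V),
    semimetric d1 -> semimetric d2 ->
    (forall s t : T, measurable_fun [set: Omega] (fun w => `|X t w - X s w|)) ->
    mixed_tail P X d1 d2 ->
    forall t0 : T,
      (forall p : R, 1 <= p ->
        ('E_P[fun w => sup (range (fun t => (`|X t w - X t0 w| `^ p)%R))] `^ (p^-1)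
         <= C%:E * (gamma_functional 2 d2 + gamma_functional 1 d1)
            + 2%:E * ereal_sup (range (fun t =>
                'E_P[fun w => (`|X t w - X t0 w| `^ p)%R] `^ (p^-1))))%E)
      /\
      (forall u : R, 1 <= u ->
        (P [set w |
              C'%:E * (gamma_functional 2 d2 + gamma_functional 1 d1)
              + (c * (Num.sqrt u * diameter d2 + u * diameter d1))%:E
              < (sup (range (fun t => `|X t w - X t0 w|%R)))%:E]
         <= (expR (- u))%:E)%E)].
Proof.
(* 4 comes from the parameter [4 * u], 300 from [30 * 10] in the chaining, and 600 from the doubling
   in [moment_le_of_tail]. *)
exists 4, 600, 300; split; rewrite ?ltr0n// => disp Omega P T d1 d2 V X sd1 sd2 mX
  tX t0.
have gamma_ge0 alpha (d : T -> T -> R) :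
    semimetric d -> (0 <= gamma_functional alpha d)%E.
  move=> sd; have [A _ /(_ t0 0%N)] := gamma_functional_attained alpha t0 sd.
  by rewrite big_nil.
have g20 := gamma_ge0 2 d2 sd2; have g10 := gamma_ge0 1 d1 sd1.
(* If the sum is [+oo], the moment bound is trivial and the event in the tail bound is empty;
   otherwise both functionals are real numbers. *)
have [gy|gy] := eqVneq (gamma_functional 2 d2 + gamma_functional 1 d1)%E +oo%E.
  have mulC (C : R) : 0 < C -> (C%:E * +oo = +oo :> \bar R)%E.
    by move=> C0; rewrite mulry gtr0_sg// mul1e.
  rewrite gy; split=> [p p1|u u1]; rewrite mulC ?ltr0n//.
    rewrite addye ?leey// gt_eqF// (@lt_le_trans _ _ 0%E)// mule_ge0//.
    apply: le_trans (ereal_sup_ubound _); last by exists t0.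
    exact: poweR_ge0.
  rewrite (_ : [set w | _] = set0) ?measure0 ?lee_fin ?expR_ge0//.
  by apply/seteqP; split=> w //=; rewrite addye// ltNge leey.
have Eg2 : gamma_functional 2 d2 = (fine (gamma_functional 2 d2))%:E.
  rewrite fineK// ge0_fin_numE// ltey; apply: contra_neq gy => ->.
  by rewrite addye// gt_eqF// (lt_le_trans _ g10).
have Eg1 : gamma_functional 1 d1 = (fine (gamma_functional 1 d1))%:E.
  rewrite fineK// ge0_fin_numE// ltey; apply: contra_neq gy => ->.
  by rewrite addey// gt_eqF// (lt_le_trans _ g20).
split=> [p p1|u u1].
  apply: le_trans (chaining_moment t0 sd1 sd2 mX tX Eg1 Eg2 p1) _.
  by rewrite [in leRHS]Eg1 [in leRHS]Eg2.
apply: le_trans (chaining_tail t0 sd1 sd2 mX tX Eg1 Eg2 u1).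
rewrite [in leLHS]Eg1 [in leLHS]Eg2 le_eqVlt; apply/orP; left; apply/eqP.
by congr (P _); apply/seteqP; split=> w /=; rewrite -EFinD -EFinM -EFinD lte_fin.
Qed.
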